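(* Let $X$ be a finite cell complex of dimension $d$ and $0\le i\le d$, with $\operatorname{rk}\widetilde H_{i+1}(X)=0$, $\operatorname{rk}\widetilde H_i(X)=1$ and $\operatorname{rk}\widetilde H_{i-1}(X)=0$. Let $\lambda^*=\sum_{U^*\in\mathcal U^i}c(C_{U^*})\,C_{U^*}\in Z^i(X)$ be the standard harmonic cocycle. Then for every cocycle $x\in Z^i(X)$, $$\lambda^*\circ x=c(x)\cdot k^i(X),$$ where $\circ$ is the standard inner product on $C_i(X)$ for which the $i$-cells are orthonormal.
   Context: Notation: $X_j$ is the finite set of $j$-cells of $X$ (in a fixed order), $C_j=C_j(X)$ is the free abelian group on $X_j$ for $0\le j\le d$, $C_{-1}=\mathbb Z$, other $C_j=0$; $\partial_j:C_j\to C_{j-1}$ is the integer cellular boundary matrix, with $\partial_0(x)=1$ for each vertex $x$ (augmented complex); $\delta_j=\partial_{j+1}^t:C_j\to C_{j+1}$. $\widetilde H_j=\ker\partial_j/\operatorname{im}\partial_{j+1}$, $Z^j=\ker\delta_j$, $B^j=\operatorname{im}\delta_{j-1}$ (all over $\mathbb Z$). $\mathcal S_i$ is the set of subcomplexes $Y$ with $X^{i-1}\subseteq Y\subseteq X^i$ ($X^j$ the $j$-skeleton); $Y$ is determined by its set $I(Y)\subseteq X_i$ of $i$-cells. For a basis $Z$ of a lattice, $[\cdot]_Z$ denotes coordinates (column by column) in that basis. The $i$-th dual tree number is $k^i(X)=\det([\delta_i]_Z[\delta_i]_Z^t)$, $Z$ a $\mathbb Z$-basis of $Z^{i+1}(X)$.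 $\mathcal U^i$: an $i$-dimensional dual cycletree is $U^*\in\mathcal S_i$ with $|I(U^* )|=\operatorname{rk}Z^{i+1}(X)+1$. Its cocycle part $C_{U^*}\in Z^i(X)$: let $A$ be the $m\times(m+1)$ submatrix of $[\delta_i]_Z$ ($m=\operatorname{rk}Z^{i+1}(X)$) with columns indexed by $I(U^* )$; the $j$-th entry of $C_{U^*}$ along $I(U^* )$ is $(-1)^j\det([A]_j)$, where $[A]_j$ is $A$ with its $j$-th column deleted; other entries are $0$. Cutting number: let $\overline\delta_{i-1}$ be a matrix whose columns form a $\mathbb Z$-basis of $B^i(X)$; for a fixed $\mathbb Z$-basis $Z'$ of $Z^i(X)$, $c(z)=\det([z]_{Z'},[\overline\delta_{i-1}]_{Z'})$ for $z\in Z^i(X)$ (well defined up to a global sign; the same choice is used throughout). *)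

(* Defs.v *)
(* MathComp, with the classical sets of MathComp-Analysis. *)
From mathcomp Require Import all_boot all_order all_algebra.
From mathcomp Require Import boolp classical_sets.

Set Implicit Arguments.
Unset Strict Implicit.
Unset Printing Implicit Defensive.

Import Order.TTheory GRing.Theory Num.Theory.
Local Open Scope classical_set_scope.
Local Open Scope ring_scope.

(* A finite cell complex of dimension d, through its ordered sets of cells and
   its integer cellular boundary matrices: the j-cells are 'I_(ncells j), and
   the columns of [bd j] are the boundaries of the (j+1)-cells. Attaching maps
   are not recorded: the notions below only depend on these matrices. *)
Record cell_complex (d : nat) := CellComplex {
  ncells : nat -> nat;
  bd : forall j, 'M[int]_(ncells j, ncells j.+1);
  ncells_vertex : (0 < ncells 0)%N;
  ncells_dim : (0 < ncells d)%N;
  ncells_above : forall j, (d < j)%N -> ncells j = 0%N;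
  bd_aug : (const_mx 1 : 'M[int]_(1, ncells 0)) *m bd 0 = 0;
  bd_bd : forall j, bd j *m bd j.+1 = 0 }.

Section Lattices.

Definition int_kernel n m (A : 'M[int]_(m, n)) : set 'cV[int]_n :=
  [set v | A *m v = 0].

Definition int_image n m (A : 'M[int]_(n, m)) : set 'cV[int]_n :=
  [set v | exists w, v = A *m w].

(* The columns of Z form a basis over the integers of the subgroup L. *)
Definition is_basis n m (L : set 'cV[int]_n) (Z : 'M[int]_(n, m)) : Prop :=
  int_image Z = L /\ (forall a : 'cV[int]_m, Z *m a = 0 -> a = 0).

(* [V]_Z, column by column; the default value 0 occurs only when some column
   of V is outside the lattice spanned by Z. *)
Definition coords n m k (Z : 'M[int]_(n, m)) (V : 'M[int]_(n, k)) :
    'M[int]_(m, k) :=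
  xget 0 [set A | Z *m A = V].

(* The columns of V are elements of K whose classes modulo L are linearly
   independent over the integers. *)
Definition indep_mod n r (K L : set 'cV[int]_n) (V : 'M[int]_(n, r)) : Prop :=
  (forall j, K (col j V)) /\ (forall a : 'cV[int]_r, L (V *m a) -> a = 0).

(* The abelian group K / L has rank r: r is the largest number of linearly
   independent elements. *)
Definition quotient_rank n (K L : set 'cV[int]_n) (r : nat) : Prop :=
  (exists V : 'M[int]_(n, r), indep_mod K L V) /\
  ~ (exists V : 'M[int]_(n, r.+1), indep_mod K L V).

Definition inner n (u v : 'cV[int]_n) : int := \sum_(s < n) u s 0 * v s 0.

End Lattices.

Section ChainComplex.
Variables (d : nat) (X : cell_complex d).

(* Degrees are shifted by one so as to include C_{-1}:
   [chain_rank k] is the rank of C_{k-1}. *)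
Definition chain_rank (k : nat) : nat :=
  if k is j.+1 then ncells X j else 1.

(* boundary j is \partial_j : C_j -> C_{j-1}, for j >= 0. *)
Definition boundary (j : nat) : 'M[int]_(chain_rank j, chain_rank j.+1) :=
  match j return 'M[int]_(chain_rank j, chain_rank j.+1) with
  | 0 => const_mx 1
  | j'.+1 => bd X j'
  end.

(* \delta_j : C_j -> C_{j+1}, for j >= 0. *)
Definition delta (j : nat) : 'M[int]_(ncells X j.+1, ncells X j) :=
  (boundary j.+1)^T.

(* The reduced homology group of degree j has rank r; in degree -1 it is the
   cokernel of the augmentation. *)
Definition homology_rank (j : int) (r : nat) : Prop :=
  match j with
  | Posz k =>
      quotient_rank (int_kernel (boundary k)) (int_image (boundary k.+1)) r
  | Negz 0 => quotient_rank setT (int_image (boundary 0)) r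
  | Negz _.+1 => r = 0%N
  end.

Definition cocycles (j : nat) : set 'cV[int]_(ncells X j) := int_kernel (delta j).

(* The image of \delta_{j-1}; when j = 0, \delta_{-1} is the transpose of the
   augmentation. *)
Definition coboundaries (j : nat) : set 'cV[int]_(ncells X j) :=
  int_image (boundary j)^T.

End ChainComplex.

Arguments cocycles {d} X j _.
Arguments coboundaries {d} X j _.

Section DualCycletrees.
Variables (d : nat) (X : cell_complex d) (i m : nat).

(* A subcomplex between the (i-1)- and i-skeleta is given by its set of
   i-cells; m is meant to be the rank of the group of (i+1)-cocycles. *)
Definition dual_cycletree : Type :=
  {I : {set 'I_(ncells X i)} | #|I| == m.+1}.

Variable Z : 'M[int]_(ncells X i.+1, m).

Definition delta_coords : 'M[int]_(m, ncells X i) := coords Z (delta X i).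

Definition dual_tree_number : int :=
  \det (delta_coords *m delta_coords^T).

(* The j-th i-cell of U, in increasing order. *)
Definition cell (U : dual_cycletree) (j : 'I_m.+1) : 'I_(ncells X i) :=
  enum_val (cast_ord (esym (eqP (valP U))) j).

(* Indices start at 0 here, hence the sign (-1)^(j+1). *)
Definition cocycle_part (U : dual_cycletree) : 'cV[int]_(ncells X i) :=
  let A : 'M[int]_(m, m.+1) := \matrix_(a, j) delta_coords a (cell U j) in
  \sum_(j < m.+1)
    ((-1) ^+ j.+1 * \det (col' j A : 'M[int]_m)) *: delta_mx (cell U j) 0.

End DualCycletrees.

(* det ([z]_Z', [B]_Z'), where the columns of Z' form a basis of the i-cocycles
   and those of B a basis of the i-coboundaries. This matrix has format
   p x (1 + q), and is square exactly when the i-th homology has rank 1;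
   conform_mx only identifies p with 1 + q. *)
Definition cutting_number n p q (Z' : 'M[int]_(n, p)) (B : 'M[int]_(n, q))
    (z : 'cV[int]_n) : int :=
  \det (conform_mx (0 : 'M[int]_p) (row_mx (coords Z' z) (coords Z' B))).

(* \lambda^* *)
Definition harmonic_cocycle d (X : cell_complex d) (i m p q : nat)
    (Z : 'M[int]_(ncells X i.+1, m))
    (Z' : 'M[int]_(ncells X i, p)) (B : 'M[int]_(ncells X i, q)) :
    'cV[int]_(ncells X i) :=
  \sum_(U : dual_cycletree X i m)
    cutting_number Z' B (cocycle_part Z U) *: cocycle_part Z U.

(* Main.v *)
Require Import Defs.
From mathcomp Require Import all_boot all_order all_algebra.
From mathcomp Require Import boolp classical_sets.
From mathcomp Require Import fingroup perm.

(** Write [D] for the matrix of [\delta_i] in the basis [Z], so that the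
    [i]-cocycles are exactly the solutions of [D x = 0] and the dual tree number
    is the Gram determinant [k = \det (D D^T)].

    Expanding along the first row, the inner product of the cocycle part [C_U]
    with any chain [y] is, up to sign, the maximal minor on the columns [U] of
    [D] augmented by [y^T] as first row. The Cauchy-Binet formula therefore gives
    [\sum_U (C_U o y) (C_U o x) = \det ([y; D] [x; D]^T)] for all [x] and [y].
    When [x] is a cocycle, the Gram matrix on the right is block triangular with
    diagonal blocks [y o x] and [D D^T]. As [y] is arbitrary,
    [\sum_U (C_U o x) C_U = k x] ([sum_inner_cocycle_part]).

    The cutting number [c] is a determinant in which the cocycle occupies one
    column, hence it is linear on cocycles ([cutting_number_linear]) once the
    determinant has positive size. It has, because a homology class of infinite
    order in degree [i] forces a nonzero cocycle ([cocycle_rank_gt0]). Each [C_U]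
    is itself a cocycle, its inner products with the rows of [D] being
    determinants with a repeated row ([cocycle_part_cocycle]). Applying [c] to the identity above gives
    [\sum_U (C_U o x) c(C_U) = k c(x)], whose left side is [\lambda^* o x]. *)

Import GRing.Theory Num.Theory.

Set Implicit Arguments.
Unset Strict Implicit.
Unset Printing Implicit Defensive.

Local Open Scope ring_scope.

(** * The Cauchy-Binet formula *)

Section CauchyBinet.
Variables (R : comPzRingType) (k n : nat).

(** The increasing enumeration of a [k]-element subset; for [k = m + 1] and
    subsets of the [i]-cells it is convertible to [cell]. *)
Definition subset_enum (U : {I : {set 'I_n} | #|I| == k}) (j : 'I_k) : 'I_n :=
  enum_val (cast_ord (esym (eqP (valP U))) j).

Lemma subset_enum_inj (U : {I : {set 'I_n} | #|I| == k}) : injective (subset_enum U).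
Proof. exact: inj_comp enum_val_inj (@cast_ord_inj _ _ _). Qed.

Lemma subset_enum_onto (U : {I : {set 'I_n} | #|I| == k}) t :
  t \in val U -> exists j, subset_enum U j = t.
Proof.
move=> Ut; exists (cast_ord (eqP (valP U)) (enum_rank_in Ut t)).
by rewrite /subset_enum cast_ordK enum_rankK_in.
Qed.

Lemma subset_enum_in (U : {I : {set 'I_n} | #|I| == k}) j : subset_enum U j \in val U.
Proof. exact: enum_valP. Qed.

Lemma imset_subset_enum_perm (U : {I : {set 'I_n} | #|I| == k}) (s : 'S_k) :
  [set subset_enum U (s j) | j : 'I_k] = val U.
Proof.
apply/setP=> t; apply/imsetP/idP=> [[j _ ->]|/subset_enum_onto[j <-]].
  exact: subset_enum_in.
by exists (s^-1 j)%g; rewrite ?permKV.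
Qed.

(** This turns the sum over functions in [det_mulmx_sum_ffun] into a sum over
    subsets and permutations. *)
Lemma injective_subset_enum_perm (f : {ffun 'I_k -> 'I_n})
    (U : {I : {set 'I_n} | #|I| == k}) :
  injective f -> [set f j | j : 'I_k] = val U ->
  exists s : 'S_k, f = [ffun j => subset_enum U (s j)].
Proof.
move=> injf imf.
have h j : exists l, subset_enum U l = f j.
  by apply: subset_enum_onto; rewrite -imf imset_f.
have [t tE] := fin_all_exists h.
have injt : injective t by move=> a b e; apply: injf; rewrite -!tE e.
by exists (perm injt); apply/ffunP=> j; rewrite ffunE permE tE.
Qed.

(** The determinant is multilinear in the rows, and row [j] of [A *m B] is the
    combination of the rows of [B] with coefficients [A j t]. *)
Lemma det_mulmx_sum_ffun (A : 'M[R]_(k, n)) (B : 'M[R]_(n, k)) :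
  \det (A *m B) =
  \sum_(f : {ffun 'I_k -> 'I_n}) (\prod_i A i (f i)) * \det (rowsub f B).
Proof.
under [RHS]eq_bigr => f _ do rewrite big_distrr.
rewrite exchange_big; apply: eq_bigr => /= s _.
under eq_bigr do rewrite mxE.
rewrite bigA_distr_bigA big_distrr; apply: eq_bigr => /= f _.
rewrite big_split mulrCA; congr (_ * (_ * _)).
by apply: eq_bigr => j _; rewrite mxE.
Qed.

(** In the expansion over functions, those that are not injective repeat a row
    and contribute nothing. The others are grouped by their range [U]; inside a
    group they differ by permutations of the rows, whose signs rebuild the minor
    of [A] on [U]. *)
Theorem cauchy_binet (A B : 'M[R]_(k, n)) :
  \det (A *m B^T) =
  \sum_(U : {I : {set 'I_n} | #|I| == k})
    \det (colsub (subset_enum U) A) * \det (colsub (subset_enum U) B).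
Proof.
rewrite det_mulmx_sum_ffun (bigID (fun f : {ffun _} => injectiveb f)) /=.
rewrite addrC big1 ?add0r => [|f /injectivePn[i1 [i2 ne e]]]; last first.
  by rewrite (determinant_alternate ne) ?mulr0 // => j; rewrite !mxE e.
pose range (f : {ffun 'I_k -> 'I_n}) := [set f j | j : 'I_k].
have card_range (f : {ffun 'I_k -> 'I_n}) : injectiveb f -> #|range f| == k.
  by move/injectiveP=> injf; rewrite card_imset ?card_ord.
transitivity (\sum_(U : {I : {set 'I_n} | #|I| == k})
    \sum_(f : {ffun 'I_k -> 'I_n} | injectiveb f && (range f == val U))
      (\prod_i A i (f i)) * \det (rowsub f B^T)).
  rewrite (partition_big range (fun I => #|I| == k)) //=.
  exact: (big_sub (fun I : {set 'I_n} => #|I| == k)).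
apply: eq_bigr => U _.
pose h (s : 'S_k) := [ffun j => subset_enum U (s j)].
have injh : injective h.
  move=> s t /ffunP est; apply/permP=> j.
  by have := est j; rewrite !ffunE => /subset_enum_inj.
rewrite (eq_bigl [in [set h s | s : 'S_k]]) => [|f]; last first.
  apply/andP/imsetP=> [[/injectiveP injf /eqP imf]|[s _ ->]].
    by have [s ->] := injective_subset_enum_perm injf imf; exists s.
  split; last first.
    by rewrite -(imset_subset_enum_perm U s); apply/eqP/eq_imset => j; rewrite ffunE.
  by apply/injectiveP=> a b; rewrite !ffunE => /subset_enum_inj/perm_inj.
rewrite big_imset /=; last by move=> ? ? _ _; apply: injh.
rewrite big_distrl /=; apply: eq_big => // s _.
have -> : rowsub (h s) B^T = row_perm s (colsub (subset_enum U) B)^T.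
  by apply/matrixP=> a b; rewrite !mxE ffunE.
rewrite row_permE det_mulmx det_perm det_tr mulrA mulrC [X in _ = X]mulrC.
congr (_ * _); rewrite mulrC; congr (_ * _).
by apply: eq_bigr => j _; rewrite !mxE ffunE.
Qed.

End CauchyBinet.

(** * The standard inner product *)

Section Inner.
Variable n : nat.
Implicit Types u v : 'cV[int]_n.

Lemma inner_mulmx u v : inner u v = (u^T *m v) 0 0.
Proof. by rewrite mxE; apply: eq_bigr => s _; rewrite mxE. Qed.

Lemma inner_deltar u s : inner u (delta_mx s 0) = u s 0.
Proof. by rewrite inner_mulmx -colE !mxE. Qed.

Lemma inner_eq0 u : inner u u = 0 -> u = 0.
Proof.
move=> /eqP; rewrite psumr_eq0 => [/allP u0|s _]; last by rewrite -expr2 sqr_ge0.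
apply/matrixP=> s j; rewrite ord1 mxE; apply/eqP.
by have := u0 s (mem_index_enum _); rewrite mulf_eq0 orbb.
Qed.

Lemma inner_suml (I : finType) (c : I -> int) (F : I -> 'cV[int]_n) v :
  inner (\sum_k c k *: F k) v = \sum_k c k * inner (F k) v.
Proof.
rewrite inner_mulmx linear_sum mulmx_suml summxE /=.
by apply: eq_bigr => k _; rewrite linearZ -scalemxAl mxE inner_mulmx.
Qed.

End Inner.

(** * Coordinates in a lattice basis *)

Section Lattices.
Variables (n p : nat) (L : set 'cV[int]_n) (Z : 'M[int]_(n, p)).
Hypothesis hZ : is_basis L Z.

Lemma basis_mulmx_inj k : injective (mulmx Z : 'M_(p, k) -> 'M_(n, k)).
Proof.
move=> A A' /eqP; rewrite -subr_eq0 -mulmxBr => /eqP e.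
apply/eqP; rewrite -subr_eq0; apply/eqP/matrixP=> a b; rewrite !mxE.
have : col b (A - A') = 0 by apply: hZ.2; rewrite colE mulmxA e mul0mx.
by move/colP/(_ a); rewrite !mxE.
Qed.

Lemma coords_mulmx k (A : 'M[int]_(p, k)) : coords Z (Z *m A) = A.
Proof. by apply: xget_unique => // A' /basis_mulmx_inj. Qed.

Lemma mulmx_coords k (V : 'M[int]_(n, k)) :
  (forall j, L (col j V)) -> Z *m coords Z V = V.
Proof.
move=> LV.
have h j : exists w, col j V = Z *m w by have := LV j; rewrite -hZ.1.
have [w wE] := fin_all_exists h.
suff -> : V = Z *m (\matrix_(a, j) w j a 0) by rewrite coords_mulmx.
apply/matrixP=> a j; have /colP/(_ a) := wE j; rewrite !mxE => ->.
by apply: eq_bigr => b _; rewrite mxE.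
Qed.

Lemma basis_coordsP v : L v -> exists a, v = Z *m a.
Proof. by rewrite -hZ.1. Qed.

End Lattices.

(** * Linearity of the cutting number *)

(** The weights are the cofactors of the first column when the matrix is square.
    Otherwise [conform_mx] returns the zero matrix of size [p], and [0 < p]
    excludes the empty matrix, whose determinant 1 is not linear. *)
Lemma det_first_col_linear p q (C : 'M[int]_(p, q)) :
  (0 < p)%N ->
  exists w : 'rV[int]_p,
    forall a : 'cV_p, \det (conform_mx (0 : 'M_p) (row_mx a C)) = (w *m a) 0 0.
Proof.
move=> p_gt0; have [pq|npq] := eqVneq p (1 + q)%N; last first.
  exists 0 => a; rewrite nonconform_mx ?mul0mx ?mxE.
    by case: p p_gt0 {C a npq} => // p _; rewrite det0.
  by rewrite [in X in _ || X]eq_sym npq orbT.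
rewrite {p_gt0}; move: C; rewrite {p}pq => C.
(* These cofactors ignore the first column, so 0 can stand for it. *)
exists (\row_s cofactor (row_mx 0 C : 'M_(1 + q)) s 0) => a.
rewrite conform_mx_id (expand_det_col _ 0) mxE; apply: eq_bigr => s _.
rewrite mulrC mxE; congr (_ * _); last first.
  by case: splitP => // j _; rewrite ord1.
rewrite [RHS]mxE /cofactor; congr (_ * \det _); apply/matrixP=> r c; rewrite !mxE.
by case: splitP => // j; rewrite ord1.
Qed.

Lemma cutting_number_linear n p q (L : set 'cV[int]_n) (Z' : 'M[int]_(n, p))
    (B : 'M[int]_(n, q)) :
  is_basis L Z' -> (0 < p)%N ->
  exists w : 'rV[int]_p,
    forall a, cutting_number Z' B (Z' *m a) = (w *m a) 0 0.
Proof.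
move=> hZ' /(det_first_col_linear (coords Z' B))[w wE]; exists w => a.
by rewrite /cutting_number (coords_mulmx hZ').
Qed.

(** * Cocycle parts of dual cycletrees *)

Section DualCycletrees.
Variables (d : nat) (X : cell_complex d) (i m : nat).
Variable Z : 'M[int]_(ncells X i.+1, m).
Hypothesis hZ : is_basis (cocycles X i.+1) Z.

Let D := delta_coords Z.
Let n := ncells X i.

Lemma mulmx_delta_coords : Z *m D = delta X i.
Proof.
apply: (mulmx_coords hZ) => j.
by rewrite /cocycles /int_kernel /mkset colE mulmxA -trmx_mul bd_bd trmx0 mul0mx.
Qed.

(** [Z] is injective, so passing to coordinates does not change the kernel. *)
Lemma cocycles_delta_coords y : cocycles X i y <-> D *m y = 0.
Proof.
rewrite /cocycles /int_kernel /mkset -mulmx_delta_coords -mulmxA.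
by split=> [/hZ.2 //|->]; rewrite mulmx0.
Qed.

(** The coefficients of the cocycle part are, up to a global sign, the cofactors
    of the first row of the augmented matrix. *)
Lemma inner_cocycle_part (U : dual_cycletree X i m) y :
  inner (cocycle_part Z U) y =
  - \det (colsub (@subset_enum m.+1 n U) (col_mx y^T D)).
Proof.
rewrite inner_suml (expand_det_row _ ord0) -sumrN; apply: eq_bigr => j _.
rewrite [X in _ = - (X * _)]mxE -[X in col_mx _ _ X](lshift0 m 0) col_mxEu mxE.
rewrite inner_mulmx trmx_delta -rowE mxE /cofactor add0n exprS mulN1r !mulNr.
rewrite mulrC; congr (- (_ * (_ * \det _))); apply/matrixP=> a b; rewrite !mxE /=.
by case: splitP => [t|t /= [/val_inj->]] //; rewrite ord1.
Qed.

(** Augmenting [D] by one of its own rows makes every maximal minor vanish, so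
    the cocycle part is orthogonal to the rows of [D]. *)
Lemma cocycle_part_cocycle (U : dual_cycletree X i m) :
  cocycles X i (cocycle_part Z U).
Proof.
apply/cocycles_delta_coords/colP=> a; rewrite [RHS]mxE.
transitivity (inner (cocycle_part Z U) (row a D)^T).
  by rewrite mxE; apply: eq_bigr => s _; rewrite !mxE mulrC.
rewrite inner_cocycle_part trmxK.
rewrite (determinant_alternate (i1 := lshift m 0) (i2 := rshift 1 a)) ?oppr0 // => j.
by rewrite /= mxE [RHS]mxE col_mxEu col_mxEd !mxE.
Qed.

(** The off-diagonal block [D *m x] of this Gram matrix vanishes. *)
Lemma det_augmented_gram y x :
  D *m x = 0 ->
  \det (col_mx y^T D *m (col_mx x^T D)^T) = inner y x * dual_tree_number Z.
Proof.
move=> Dx; rewrite tr_col_mx mul_col_row trmxK Dx det_ublock.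
by rewrite det_mx11 inner_mulmx.
Qed.

(** Entry by entry, that is, paired with a standard basis vector [y], the left
    side is the Cauchy-Binet expansion of the Gram determinant of
    [det_augmented_gram]; the signs of the two cocycle parts cancel. *)
Theorem sum_inner_cocycle_part x :
  cocycles X i x ->
  \sum_(U : dual_cycletree X i m)
     inner (cocycle_part Z U) x *: cocycle_part Z U =
  dual_tree_number Z *: x.
Proof.
move=> /cocycles_delta_coords Dx; apply/colP=> s.
set y : 'cV[int]_n := delta_mx s 0.
rewrite -[LHS]inner_deltar inner_suml -/y mxE mulrC -[x s 0]inner_deltar -/y.
transitivity (inner y x * dual_tree_number Z); last first.
  by congr (_ * _); apply: eq_bigr => t _; rewrite mulrC.
rewrite -(det_augmented_gram y Dx).
rewrite (@cauchy_binet _ m.+1 n); apply: eq_bigr => U _.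
by rewrite !inner_cocycle_part mulrNN mulrC.
Qed.

End DualCycletrees.

(** * The harmonic cocycle *)

(** If [\delta_i] were injective, the Gram matrix [G = \partial_{i+1} \delta_i]
    would have a nonzero determinant, and the adjugate of [G] would show
    that [\det G] annihilates every [i]-chain modulo boundaries. This is
    incompatible with a homology class of infinite order. *)
Lemma cocycle_rank_gt0 d (X : cell_complex d) i p
    (Z' : 'M[int]_(ncells X i, p)) :
  homology_rank X i%:Z 1 -> is_basis (cocycles X i) Z' -> (0 < p)%N.
Proof.
move=> [[V [_ indepV]] _] hZ'; rewrite lt0n; apply/negP=> /eqP p0; subst p.
pose G := (delta X i)^T *m delta X i.
(* [V] represents a class of infinite order and [V * \det G] bounds. *)
have : \det G = 0.
  have /indepV/colP/(_ 0) : int_image (boundary X i.+1) (V *m (\det G)%:M).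
    exists (delta X i *m \adj G *m V).
    by rewrite -[boundary X i.+1]trmxK !mulmxA mul_mx_adj scalar_mxC.
  by rewrite !mxE.
move=> /eqP/det0P[v v0 vG]; case/negP: v0.
have /(basis_coordsP hZ')[a vE] : cocycles X i v^T.
  by apply: inner_eq0; rewrite inner_mulmx trmx_mul trmxK mulmxA -(mulmxA v) vG mul0mx mxE.
by rewrite -[v]trmxK vE [a]flatmx0 mulmx0 trmx0.
Qed.

Unset Implicit Arguments.

Theorem theorem8p0p1 (d : nat) (X : cell_complex d) (i : nat)
    (hi : (i <= d)%N)
    (hH_succ : homology_rank X i.+1%:Z 0)
    (hH : homology_rank X i%:Z 1)
    (hH_pred : homology_rank X (i%:Z - 1) 0)
    (m p q : nat)
    (Z : 'M[int]_(ncells X i.+1, m)) (hZ : is_basis (cocycles X i.+1) Z)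
    (Z' : 'M[int]_(ncells X i, p)) (hZ' : is_basis (cocycles X i) Z')
    (B : 'M[int]_(ncells X i, q)) (hB : is_basis (coboundaries X i) B)
    (x : 'cV[int]_(ncells X i)) (hx : cocycles X i x) :
  inner (harmonic_cocycle Z Z' B) x
  = cutting_number Z' B x * dual_tree_number Z.
Proof.
have [w cE] := cutting_number_linear B hZ' (cocycle_rank_gt0 hH hZ').
have [a xE] := basis_coordsP hZ' hx.
have [b CE] := fin_all_exists (fun U =>
  basis_coordsP hZ' (cocycle_part_cocycle hZ U)).
have sum_b : \sum_U inner (cocycle_part Z U) x *: b U = dual_tree_number Z *: a.
  apply: (basis_mulmx_inj hZ'); rewrite -scalemxAr -xE.
  rewrite -(sum_inner_cocycle_part hZ hx) mulmx_sumr.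
  by apply: eq_bigr => U _; rewrite -scalemxAr -CE.
rewrite inner_suml [in X in X * _]xE cE mulrC.
transitivity ((w *m (dual_tree_number Z *: a)) 0 0); last first.
  by rewrite -scalemxAr mxE.
rewrite -sum_b mulmx_sumr summxE; apply: eq_bigr => U _.
by rewrite [in cutting_number _ _ _]CE cE -scalemxAr [RHS]mxE mulrC.
Qed.
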